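(* Let $r$ be a positive integer, and let $\mathcal{F}$ be a finite family of graphs such that $K_{1,r+1}\in\mathcal{F}$ and every other $F\in\mathcal{F}$ contains at least one cycle. Then $\mathcal{F}$ is $k$-nice for infinitely many positive integers $k$.
   Context: Graphs are finite and simple. $K_{1,r+1}$ is the star with $r+1$ edges. A copy of a graph means a copy as a subgraph, not necessarily induced. For a family $\mathcal{F}$ of graphs and a positive integer $k$, $R_k(\mathcal{F})$ is the smallest integer $n$ such that every coloring of $E(K_n)$ with $k$ colors (not necessarily proper) yields a monochromatic copy of some $F\in\mathcal{F}$. The family $\mathcal{F}$ is $k$-nice if for every graph $G$ with chromatic number $\chi(G)=R_k(\mathcal{F})$ and every $k$-coloring of $E(G)$ there is a monochromatic copy of some $F\in\mathcal{F}$. *)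

(* Defs.v *)
From mathcomp Require Import all_boot.

Set Implicit Arguments.
Unset Strict Implicit.
Unset Printing Implicit Defensive.

Record sgraph := SGraph {
  vert :> finType;
  adj : rel vert;
  adj_sym : symmetric adj;
  adj_irrefl : irreflexive adj }.

Definition complete_adj n : rel 'I_n := fun x y => x != y.

Lemma complete_sym n : symmetric (@complete_adj n).
Proof. by move=> x y; rewrite /complete_adj eq_sym. Qed.

Lemma complete_irrefl n : irreflexive (@complete_adj n).
Proof. by move=> x; rewrite /complete_adj eqxx. Qed.

Definition complete n := SGraph (@complete_sym n) (@complete_irrefl n).

(* K_{1,m}: the centre is None, the leaves are Some i. *)
Definition star_adj m : rel (option 'I_m) := fun x y => isSome x (+) isSome y.

Lemma star_sym m : symmetric (@star_adj m).
Proof. by move=> x y; rewrite /star_adj addbC. Qed.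

Lemma star_irrefl m : irreflexive (@star_adj m).
Proof. by move=> x; rewrite /star_adj addbb. Qed.

Definition star m := SGraph (@star_sym m) (@star_irrefl m).

Definition isomorphic (G H : sgraph) : Prop :=
  exists2 f : G -> H, bijective f & forall x y, adj (f x) (f y) = adj x y.

Definition has_cycle (G : sgraph) : Prop :=
  exists s : seq G, ucycle (@adj G) s /\ 2 < size s.

Definition colorable (G : sgraph) (m : nat) : bool :=
  [exists f : {ffun G -> 'I_m}, forall x, forall y, adj x y ==> (f x != f y)].

Lemma colorable_ex (G : sgraph) : exists m, colorable G m.
Proof.
exists #|G|; apply/existsP; exists [ffun x => enum_rank x].
apply/forallP => x; apply/forallP => y; apply/implyP => xy.
rewrite !ffunE (inj_eq enum_rank_inj).
by apply: contraTneq xy => ->; rewrite adj_irrefl.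
Qed.

Definition chromatic_number (G : sgraph) : nat := ex_minn (colorable_ex G).

(* The edge xy is the unordered pair [set x; y]. A k-coloring of E(G) is given
   by a map on all vertex sets, whose values outside E(G) are never used; for
   k > 0 every map E(G) -> 'I_k extends to such a map. *)
Definition edge_coloring (k : nat) (G : sgraph) := {set G} -> 'I_k.

Definition mono_copy k (F G : sgraph) (c : edge_coloring k G) : Prop :=
  exists (f : F -> G) (a : 'I_k), injective f /\
    forall x y, adj x y -> adj (f x) (f y) /\ c [set f x; f y] = a.

Definition forces (k : nat) (I : finType) (fam : I -> sgraph) (G : sgraph) :
    Prop :=
  forall c : edge_coloring k G, exists i, mono_copy (fam i) c.

Definition is_ramsey_number (k : nat) (I : finType) (fam : I -> sgraph)
    (n : nat) : Prop :=
  forces k fam (complete n) /\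
  forall m, forces k fam (complete m) -> n <= m.

(* The existence of R_k is part of the definition, so that niceness can never
   hold vacuously. *)
Definition nice (k : nat) (I : finType) (fam : I -> sgraph) : Prop :=
  exists n, is_ramsey_number k fam n /\
    forall G : sgraph, chromatic_number G = n -> forces k fam G.

(* Main.v *)
Require Import Defs.
From Stdlib Require Import Classical.
From mathcomp Require Import all_boot all_fingroup.

(** Let n = kr. If K_n can be k-coloured with all colour classes of maximum
    degree at most r and of large girth, then R_k is n+1 or n+2, and niceness
    follows from Brooks' theorem: a graph of chromatic number R_k either has a
    vertex of degree above kr, hence a monochromatic star, or contains the
    complete graph on R_k vertices.

    For infinitely many k such a colouring is obtained as follows. Let W be the
    vertex set of an r-regular Cayley graph of large girth generated by r
    involutions, w0 a vertex, and A the set of all pairs of a permutation of W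
    and a copy number; each element of A gives a relabelled copy of the Cayley
    graph. By symmetry each pair u, v lies in the same number q of copies, so
    that q (|W| - 1) = |A| r. Use the points (g, u) with g in Z/q and u <> w0,
    and colour the edge from (g, u) to (g', v) by the (g + g')-th copy
    containing the edge uv, or containing u w0 if u = v. A short cycle in one
    colour projects to a reduced walk in one copy which stays put instead of
    stepping to w0, and this contradicts the girth of the Cayley graph. *)

Set Implicit Arguments.
Unset Strict Implicit.
Unset Printing Implicit Defensive.

(** * Brooks' theorem *)

Section Brooks.

Variables (T : finType) (e : rel T) (D : nat).
Hypotheses (e_sym : symmetric e) (e_irr : irreflexive e).
Hypothesis deg_le : forall x, #|[set y | e x y]| <= D.

Definition proper_on (f : T -> 'I_D) (A : {set T}) :=
  {in A &, forall x y, e x y -> f x != f y}.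

Lemma proper_onS f (A B : {set T}) :
  A \subset B -> proper_on f B -> proper_on f A.
Proof. by move=> /subsetP sAB fB x y /sAB xB /sAB; apply: fB. Qed.

Definition extension (f : T -> 'I_D) (A : {set T}) (f' : T -> 'I_D) B :=
  {in A, f' =1 f} /\ proper_on f' B.

Lemma recolor f (A : {set T}) x a : x \notin A -> proper_on f A ->
  {in A, forall y, e x y -> f y != a} ->
  extension f A (fun y => if y == x then a else f y) (x |: A).
Proof.
move=> xA fA aA; split=> [y yA | y z].
  by case: eqP => // yx; rewrite -yx yA in xA.
rewrite !inE; case: (eqVneq y x) => [-> | yx]; case: (eqVneq z x) => [-> | zx] //=.
- by rewrite e_irr.
- by move=> zA xz; rewrite eq_sym; apply: aA.
- by move=> yA _ yx'; apply: aA => //; rewrite e_sym.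
- by apply: fA.
Qed.

(** The bound is on colours, not on coloured neighbours, so it also covers a vertex with [D]
    coloured neighbours two of which share a colour. *)
Lemma extend_vertex f (A : {set T}) x : x \notin A -> proper_on f A ->
  #|f @: ([set y | e x y] :&: A)| < D ->
  exists f', extension f A f' (x |: A).
Proof.
move=> xA fA imD.
have /set0Pn [a] : ~: (f @: ([set y | e x y] :&: A)) != set0.
  rewrite -card_gt0 -subn_gt0 in imD *.
  by rewrite cardsCs setCK card_ord.
rewrite inE => aP; eexists; apply: (recolor (a := a)) => // y yA xy.
by apply: contraNneq aP => <-; apply: imset_f; rewrite !inE xy.
Qed.

(** Greedy colouring: when a vertex of [s] is reached, its successor is still uncoloured, so fewer
    than [D] of its neighbours are coloured. *)
Lemma extend_path f (A : {set T}) s z : sorted e (rcons s z) -> uniq (rcons s z) ->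
  {in rcons s z, forall y, y \notin A} -> proper_on f A ->
  exists f', extension f A f' (A :|: [set:: s]).
Proof.
elim: s f A => [|x s IHs] f A /=.
  by move=> _ _ _ fA; exists f; split=> //; rewrite setU0.
move=> xs /andP[xs' us] sA fA.
have xA : x \notin A by apply: sA; rewrite mem_head.
have [y /andP[xy ys]] : exists y, e x y && (y \in rcons s z).
  case: s xs {IHs xs' us sA} => [|y s] /= /andP[xy _];
    by [exists z; rewrite xy mem_head | exists y; rewrite xy mem_head].
have [|g [gf gA]] := extend_vertex xA fA.
  apply: leq_ltn_trans (leq_imset_card _ _) _.
  apply: leq_trans (deg_le x); apply: proper_card; apply/properP.
  split; first exact: subsetIl.
  exists y; first by rewrite inE.
  by rewrite !inE negb_and sA ?orbT // inE ys orbT.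
have [|h [hg hA]] := IHs g (x |: A) (path_sorted xs) us _ gA.
  move=> w ws; rewrite !inE negb_or sA ?inE ?ws ?orbT // andbT.
  by apply: contraNneq xs' => <-.
exists h; split=> [w wA | ]; first by rewrite hg ?gf // !inE wA orbT.
apply: proper_onS hA; apply/subsetP => w; rewrite !inE.
by case/or3P=> ->; rewrite ?orbT.
Qed.

(** The last vertex [z] may have all its neighbours coloured, but [y1] and [y2] share a colour, so
    it sees fewer than [D] colours. *)
Lemma extend_path_closing f (A : {set T}) s z y1 y2 : sorted e (rcons s z) ->
  uniq (rcons s z) -> {in rcons s z, forall y, y \notin A} -> proper_on f A ->
  y1 \in A -> y2 \in A -> e z y1 -> e z y2 -> y1 != y2 -> f y1 = f y2 ->
  exists f', extension f A f' (A :|: [set:: rcons s z]).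
Proof.
move=> ps us sA fA y1A y2A zy1 zy2 y12 fy.
have [g [gf gA]] := extend_path ps us sA fA.
have zs : z \notin A :|: [set:: s].
  move: us; rewrite rcons_uniq !inE negb_or => /andP[-> _].
  by rewrite sA // mem_rcons mem_head.
have [|h [hg hA]] := extend_vertex zs gA.
  set N := _ :&: _; have y1N : y1 \in N by rewrite !inE zy1 y1A.
  apply: leq_trans (deg_le z).
  apply: (@leq_trans #|N|); last by rewrite subset_leq_card // subsetIl.
  rewrite (cardsD1 y1) y1N ltnS; apply: leq_trans (leq_imset_card g _).
  apply: subset_leq_card; apply/subsetP => _ /imsetP[w wN ->].
  have [-> | wy1] := eqVneq w y1; last by apply: imset_f; rewrite 2!inE wy1.
  by rewrite !gf // fy -gf //; apply: imset_f; rewrite !inE eq_sym y12 zy2 y2A.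
exists h; split=> [w wA | ]; first by rewrite hg ?gf // !inE wA.
apply: proper_onS hA; apply/subsetP => w; rewrite !inE mem_rcons inE.
by case/or3P=> ->; rewrite ?orbT.
Qed.

Lemma maximal_path (S : {set T}) x p :
  path e x p -> uniq (x :: p) -> {subset x :: p <= S} ->
  exists t, [/\ path e x (p ++ t), uniq (x :: p ++ t),
    {subset x :: p ++ t <= S} &
    {in S, forall y, e (last x (p ++ t)) y -> y \in x :: p ++ t}].
Proof.
have [n] := ubnP (#|S| - size p); elim: n p => // n IHn p Sn xp up pS.
have [/existsP[y /and3P[yS ly yp]] | ] :=
    boolP [exists y, [&& y \in S, e (last x p) y & y \notin x :: p]].
  have upy : uniq (x :: rcons p y) by rewrite -rcons_cons rcons_uniq yp.
  have pyS : {subset x :: rcons p y <= S}.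
    move=> w; rewrite -rcons_cons mem_rcons in_cons.
    by case/predU1P=> [-> | /pS].
  have pyS' : size (rcons p y) < #|S|.
    rewrite -[(size _).+1]/(size (x :: rcons p y)) -(card_uniqP upy).
    by apply: subset_leq_card; apply/subsetP.
  have [|| t] := IHn (rcons p y) _ _ upy pyS.
  - rewrite size_rcons in pyS' *; rewrite -ltnS (leq_trans _ Sn) // ltnS.
    by rewrite ltn_sub2l // ltnW.
  - by rewrite rcons_path xp.
  by rewrite cat_rcons => Ht; exists (y :: t).
rewrite negb_exists => /forallP max; exists [::]; rewrite cats0; split=> //.
by move=> y yS ly; move: (max y); rewrite yS ly /= negbK.
Qed.

(** Starting from the common colour of [x] and [y], colour [p1] forwards, then [p2] backwards, then
    [z], whose neighbour [v] is still uncoloured, and finally [v], which sees one colour twice. *)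
Lemma color_spanning_path (f : T -> 'I_D) x v y p1 z p2 :
  path e y (p1 ++ z :: p2) -> uniq [:: x, v, y & p1 ++ z :: p2] ->
  e v x -> e v y -> e v z -> ~~ e x y -> f x = f y ->
  exists f', proper_on f' [set:: [:: x, v, y & p1 ++ z :: p2]].
Proof.
move=> yp up vx vy vz nxy fxy.
have xy : x != y by move: up; rewrite /= !inE => /andP[/norP[_ /norP[]]].
have fP : proper_on f [set x; y].
  move=> a b; rewrite !inE => /orP[] /eqP-> /orP[] /eqP->; rewrite ?e_irr //.
    by rewrite (negPf nxy).
  by rewrite e_sym (negPf nxy).
have xyp w : w \in v :: p1 ++ z :: p2 -> w \notin [set x; y].
  move: up; rewrite /= !inE => /and4P[/norP[xv /norP[_ xp]] /norP[vy' _] yp' _].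
  case/predU1P=> [-> | wp]; first by rewrite negb_or eq_sym xv.
  by apply/norP; split; [apply: contraNneq xp | apply: contraNneq yp'] => <-.
move: up; rewrite 3!cons_uniq => /and4P[_ vp _ up].
move: vp; rewrite inE => /norP[_ vp].
have [|||f1 [f1f f1P]] := @extend_path f [set x; y] p1 z _ _ _ fP.
- by move: yp; rewrite -cat_rcons cat_path => /andP[/path_sorted].
- by move: up; rewrite -cat_rcons cat_uniq => /andP[].
- by move=> w wp; rewrite xyp // -cat_rcons in_cons mem_cat wp orbT.
have [|||||||f2 [_ f2P]] :=
    @extend_path_closing f1 _ (rev (z :: p2)) v x y _ _ _ f1P _ _ vx vy.
- rewrite -rev_cons rev_sorted /= e_sym vz.
  move: yp; rewrite cat_path /= => /and3P[_ _].
  by rewrite (eq_path (e' := fun a b => e b a)).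
- rewrite -rev_cons rev_uniq cons_uniq; move: vp up.
  by rewrite mem_cat cat_uniq => /norP[_ ->] /and3P[].
- move=> w; rewrite -rev_cons mem_rev => wp.
  rewrite in_setU negb_or xyp /=; last first.
    by move: wp; rewrite !in_cons mem_cat in_cons => /or3P[] ->; rewrite ?orbT.
  rewrite inE; apply: contraL wp => wp1.
  rewrite in_cons negb_or; apply/andP; split.
    by apply: contraNneq vp => <-; rewrite mem_cat wp1.
  by move: up; rewrite cat_uniq => /and3P[_ /hasPn wp _]; apply: contraL wp1 => /wp.
- by rewrite !inE eqxx.
- by rewrite !inE eqxx orbT.
- exact: xy.
- by rewrite !f1f ?inE ?eqxx ?orbT.
exists f2; apply: proper_onS f2P; apply/subsetP => w.
rewrite !inE -rev_cons mem_rev !in_cons mem_cat in_cons.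
by do ![case/orP]=> ->; rewrite ?orbT.
Qed.

Lemma split_first_has (P : pred T) s : has P s ->
  exists s1 z s2, [/\ s = s1 ++ z :: s2, P z & ~~ has P s1].
Proof.
elim: s => //= z s IHs; have [Pz _ | Pz /= /IHs[s1 [w [s2 [-> Pw s1P]]]]] := boolP (P z).
  by exists [::], z, s.
by exists (z :: s1), w, s2; rewrite /= negb_or Pz.
Qed.

Lemma split_last_has (P : pred T) s : has P s ->
  exists s1 z s2, [/\ s = s1 ++ z :: s2, P z & ~~ has P s2].
Proof.
elim/last_ind: s => // s z IHs; rewrite has_rcons.
have [Pz _ | Pz /= /IHs[s1 [w [s2 [-> Pw s2P]]]]] := boolP (P z).
  by exists s, z, [::]; rewrite cats1.
by exists s1, w, (rcons s2 z); rewrite rcons_cat has_rcons negb_or Pz.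
Qed.

Lemma color_cycle f (A : {set T}) c h z : path.cycle e c -> uniq c ->
  {in c, forall y, y \notin A} -> proper_on f A ->
  h \in c -> {in A, forall y, ~~ e h y} -> z \in c -> [exists w in A, e z w] ->
  exists f', proper_on f' (A :|: [set:: c]).
Proof.
(* Rotate [c] so that its first vertex has no neighbour in [A] but its last
   one has such a neighbour [w]; the first vertex may then be coloured as [w]. *)
move=> ec uc cA fA hc hA zc zA; pose P y := [exists w in A, e y w].
have Ph : ~~ P h by apply/exists_inPn.
have {hA z zc zA} [h' [s [z [ec' uc' cc' [Ph' Pz]]]]] : exists h' s z,
    [/\ path.cycle e (h' :: rcons s z), uniq (h' :: rcons s z),
        c =i h' :: rcons s z & ~~ P h' /\ P z].
  have [i c' rc] := rot_to hc.
  have /split_last_has[s1 [z' [s2 [Ds Pz s2P]]]] : has P (rot i c).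
    by apply/hasP; exists z; rewrite ?mem_rot.
  have Dr : rot (size (rcons s1 z')) (rot i c) = s2 ++ rcons s1 z'.
    by rewrite Ds -cat_rcons rot_size_cat.
  have [t Dt] : exists t, s2 ++ rcons s1 z' = rcons t z'.
    by exists (s2 ++ s1); rewrite rcons_cat.
  have [h' [s [Dt' Ph']]] : exists h' s, t = h' :: s /\ ~~ P h'.
    case: s1 Ds Dr Dt => [|a s1] Ds _ Dt.
      by move: Pz; rewrite rc in Ds; case: Ds Ph => <- _ /negPf->.
    have ah : a = h by move: Ds; rewrite rc => -[].
    move: Dt; rewrite -rcons_cat => /rcons_inj[<-].
    case: s2 s2P {Ds} => [|b s2] /=; first by exists h, s1; rewrite ah.
    by rewrite negb_or => /andP[Pb _]; exists b, (s2 ++ a :: s1).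
  exists h', s, z'; rewrite -rcons_cons -Dt' -Dt -Dr.
  split=> //; rewrite ?rot_cycle ?rot_uniq //.
  by move=> y; rewrite !mem_rot.
have [w wA zw] := exists_inP Pz.
have h'A : h' \notin A by apply: cA; rewrite cc' mem_head.
have hA y : y \in A -> ~~ e h' y by apply/exists_inPn.
have [|g_f gP] := recolor (a := f w) h'A fA.
  by move=> y /hA /negPf->.
set g := (fun y => _) in g_f gP.
have [zh' sz] : e z h' /\ sorted e (rcons s z).
  by move: ec'; rewrite /= rcons_path last_rcons => /andP[/path_sorted].
have /andP[h's us] := uc'.
have [|||||f' [_ f'P]] := extend_path_closing sz us _ gP _ _ zh' zw.
- move=> y ys; rewrite !inE negb_or cA ?cc' ?in_cons ?ys ?orbT // andbT.
  by apply: contraNneq h's => <-.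
- by rewrite !inE eqxx.
- by rewrite !inE wA orbT.
- by apply: contraNneq h'A => ->.
- by rewrite (g_f w wA) /g eqxx.
exists f'; apply: proper_onS f'P; apply/subsetP => y.
by rewrite !inE cc' in_cons; case/or3P=> ->; rewrite ?orbT.
Qed.

Lemma last_has_neighbour x s :
  path e x s -> s != [::] -> has (e (last x s)) (x :: s).
Proof.
case: (lastP s) => // {}s l; rewrite rcons_path last_rcons => /andP[_ sl] _.
by apply/hasP; exists (last x s); rewrite 1?e_sym // -rcons_cons mem_rcons inE mem_last orbT.
Qed.

Hypothesis D_gt2 : 2 < D.
Hypothesis clique_free :
  forall K : {set T}, #|K| = D.+1 -> exists x y, [/\ x \in K, y \in K, x != y & ~~ e x y].

(* The induction follows Zajac: a longest path starting with an induced
   path [x, v, y] either spans [S], or ends in a cycle outside of which the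
   last vertex has no neighbour. *)
Lemma brooks_on (S : {set T}) : exists f, proper_on f S.
Proof.
have [n] := ubnP #|S|; elim: n S => // n IHn S Sn.
have IH (B : {set T}) : B \proper S -> exists f, proper_on f B.
  by move=> /proper_card BS; apply: IHn; apply: leq_trans BS _.
have [-> | /set0Pn [v vS]] := eqVneq S set0.
  by exists (fun=> Ordinal (ltnW (ltnW D_gt2))) => x; rewrite inE.
(* A vertex with fewer than [D] neighbours in [S] can be coloured last. Otherwise [v] has exactly
   [D] neighbours, all in [S]. *)
have [degv | degv] := ltnP #|[set y | e v y] :&: S| D.
  have [f fP] := IH _ (properD1 vS).
  have vSv : v \notin S :\ v by rewrite !inE eqxx.
  have [|f' []] := extend_vertex vSv fP; last by rewrite setD1K //; exists f'.
  apply: leq_ltn_trans (leq_imset_card _ _) _; apply: leq_ltn_trans degv.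
  by apply: subset_leq_card; apply: setIS; apply: subD1set.
have NS : [set y | e v y] \subset S.
  apply/setIidPl/eqP; rewrite eqEcard subsetIl /=; exact: leq_trans degv.
have degvD : #|[set y | e v y]| = D.
  by apply/eqP; rewrite eqn_leq deg_le -(setIidPl NS).
(* The closed neighbourhood of [v] has [D.+1] elements, so it is not a clique. *)
have [x [y [vx vy xy nxy]]] : exists x y, [/\ e v x, e v y, x != y & ~~ e x y].
  have [|x [y []]] := @clique_free (v |: [set y | e v y]).
    by rewrite cardsU1 inE e_irr degvD.
  rewrite !inE => /predU1P[->|vx] /predU1P[->|vy]; rewrite ?eqxx //.
  - by rewrite vy.
  - by rewrite e_sym vx.
  - by exists x, y.
have inS w : e v w -> w \in S by move=> vw; apply: (subsetP NS); rewrite inE.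
have [||| p []] := @maximal_path S x [:: v; y].
- by rewrite /= e_sym vx vy.
- rewrite /= !inE negb_or xy !andbT; apply/andP; split.
    by apply: contraTneq vx => ->; rewrite e_irr.
  by apply: contraTneq vy => ->; rewrite e_irr.
- by move=> w; rewrite !inE => /or3P[] /eqP-> //; apply: inS.
rewrite [_ ++ _]/= => xp up pS maxp.
have [Sp | Sp] := boolP (S \subset [set:: [:: x, v, y & p]]).
  (* As [D > 2], there is a neighbour of [v] besides [x] and [y]. *)
  have [z /and4P[vz zv zx zy]] : exists z, [&& e v z, z != v, z != x & z != y].
    have : [set y | e v y] :\: [set x; y] != set0.
      rewrite -card_gt0 -(ltn_add2l #|[set y | e v y] :&: [set x; y]|) cardsID.
      rewrite addn0 degvD; apply: leq_ltn_trans D_gt2.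
      apply: leq_trans (subset_leq_card (subsetIr _ _)) _.
      by rewrite cards2; case: eqP.
    case/set0Pn => z; rewrite !inE negb_or => /andP[/andP[zx zy] vz].
    by exists z; rewrite vz zx zy !andbT; apply: contraTneq vz => ->; rewrite e_irr.
  have zp : z \in p.
    have := subsetP Sp _ (inS _ vz).
    by rewrite !inE (negPf zv) (negPf zx) (negPf zy).
  move: xp up Sp {maxp pS}; case/splitPr: zp => p1 p2 /= /and3P[_ _ yp] up Sp.
  have [|f fP] := @color_spanning_path (fun=> Ordinal (ltnW (ltnW D_gt2)))
    _ _ _ _ _ _ yp up vx vy vz nxy; first by [].
  by exists f; apply: proper_onS fP.
set q := [:: x, v, y & p] in up pS maxp Sp.
have qp : sorted e q by [].
have lq : last x q \in q by apply: (mem_last x [:: v, y & p]).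
(* From the first neighbour [w] of its end, the path closes to a cycle; by maximality this cycle
   contains all neighbours of the end in [S]. *)
have [s1 [w [s2 [Dq lw s1l]]]] : exists s1 w s2,
    [/\ q = s1 ++ w :: s2, e (last x q) w & ~~ has (e (last x q)) s1].
  by apply: split_first_has; apply: (@last_has_neighbour x [:: v, y & p]).
have lqE : last x q = last w s2 by rewrite Dq last_cat.
rewrite lqE in lw s1l lq maxp.
have cw : path.cycle e (w :: s2).
  rewrite /= rcons_path lw andbT.
  by move: qp; rewrite Dq; case: (s1) => //= a s; rewrite cat_path /= => /and3P[].
have uw : uniq (w :: s2) by move: up; rewrite Dq cat_uniq => /and3P[].
have [C mC] : exists C : {set T}, C =i w :: s2.
  by exists [set:: w :: s2] => a; rewrite inE.
have CS : C \subset S.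
  by apply/subsetP => a; rewrite mC => aw; apply: pS; rewrite Dq mem_cat aw orbT.
have wC : w \in C by rewrite mC mem_head.
have SC : S = (S :\: C) :|: C by rewrite setUC -{1}(setIidPr CS) setID.
have [|f fP] := IH (S :\: C).
  rewrite properE subsetDl; apply/subsetPn; exists w; last by rewrite inE wC.
  exact: (subsetP CS).
(* If an edge leaves the cycle, colour the rest first and then the cycle. Otherwise colour both
   parts independently; the cycle is a proper part because the path does not span [S]. *)
have [/exists_inP [z zC zw] | /exists_inPn noC] :=
    boolP [exists z in C, [exists w in S :\: C, e z w]].
  have [|||f' f'P] := @color_cycle f (S :\: C) (w :: s2) (last w s2) z cw uw _ fP
    (mem_last _ _) _ _ zw.
  - by move=> a aw; rewrite in_setD mC aw.
  - move=> a; rewrite in_setD mC => /andP[aw aS]; apply: contra aw; rewrite -lqE => la.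
    have := maxp _ aS la; rewrite Dq mem_cat => /orP[as1|//].
    by case/hasP: s1l; exists a; rewrite -?lqE.
  - by rewrite -mC.
  exists f'; apply: proper_onS f'P; rewrite {1}SC setUS //.
  by apply/subsetP => a; rewrite mC inE.
have [|g gP] := IH C.
  rewrite properE CS; apply: contra Sp => /subset_trans; apply.
  by apply/subsetP => a; rewrite mC Dq inE mem_cat => ->; rewrite orbT.
exists (fun a => if a \in C then g a else f a) => a b aS bS ab.
have [aC | aC] := boolP (a \in C); have [bC | bC] := boolP (b \in C).
- exact: gP.
- by have /exists_inPn/(_ b) := noC a aC; rewrite inE bC bS ab => /(_ isT).
- by have /exists_inPn/(_ a) := noC b bC; rewrite inE aC aS e_sym ab => /(_ isT).
- by apply: fP; rewrite ?inE ?aC ?bC.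
Qed.

Lemma brooks : exists f : T -> 'I_D, forall x y, e x y -> f x != f y.
Proof.
by have [f fP] := brooks_on setT; exists f => x y; apply: fP; rewrite inE.
Qed.

End Brooks.

(** * Regular graphs of large girth from involutions *)

(* Words beginning with [:: c, c] are fixed, so that this is an involution on all words. *)
Definition toggle_head (L : eqType) (R : nat) (c : L) (w : seq L) : seq L :=
  if w is b :: w' then
    if b == c then if ohead w' == Some c then w else w'
    else if size w < R then c :: w else w
  else if size w < R then c :: w else w.

Lemma toggle_headK (L : eqType) R (c : L) w : size w <= R ->
  toggle_head R c (toggle_head R c w) = w.
Proof.
case: w => [|b w] /=.
  by case: R => //= R _; rewrite eqxx.
have [-> | bc] := eqVneq b c.
  case: w => [|a w] /= wR; first by rewrite ifT.
  rewrite -[Some a == Some c]/(a == c).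
  have [-> | ac] := eqVneq a c; first by rewrite /= !eqxx.
  by rewrite /= (negPf ac) wR.
move=> _; case: ltnP => /= wR.
  by rewrite eqxx -[Some b == Some c]/(b == c) (negPf bc).
by rewrite (negPf bc) ltnNge wR.
Qed.

Lemma size_toggle_head (L : eqType) R (c : L) w : size w <= R ->
  size (toggle_head R c w) <= R.
Proof.
case: w => [|b w] /= wR; first by case: ltnP => // ->.
by case: eqP => _; case: ifP => //= _; exact: ltnW.
Qed.

(** A reduced word meets neither a cancellation nor the length bound, so its letters pile up. *)
Lemma foldl_toggle_head (L : eqType) R (cs w : seq L) :
  size w + size cs <= R -> sorted (fun a b => a != b) cs ->
  (if cs is c :: _ then ohead w != Some c else true) ->
  foldl (fun u c => toggle_head R c u) w cs = catrev cs w.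
Proof.
elim: cs w => //= c cs IHcs w wR pcs wc.
have -> : toggle_head R c w = c :: w.
  have sw : size w < R by apply: leq_trans wR; rewrite addnS ltnS leq_addr.
  case: w sw wc {wR} => [|b w] /= sw wc; rewrite ?sw //.
  by rewrite ifN //; apply: contra wc => /eqP->.
apply: IHcs; rewrite ?addSnnS //; first exact: path_sorted pcs.
by case: cs pcs {wR} => //= d cs /andP[cd _]; apply: contra cd => /eqP[->].
Qed.

(* Permutations [toggle_head R c] of the words of length at most [R]: a reduced
   product of at most [R] of them moves the empty word. *)
Lemma high_girth_action (r R : nat) : exists (W : finType) (act : W -> 'I_r -> W) (w0 : W),
  (forall c, involutive (act^~ c)) /\
  forall u cs, 0 < size cs <= R -> sorted (fun a b => a != b) cs ->
    foldl act u cs != u.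
Proof.
pose T := (R.-bseq 'I_r)%type.
pose tog c (w : T) : T := Bseq (size_toggle_head c (size_bseq w)).
have togK c : involutive (tog c).
  by move=> w; apply/val_inj; rewrite /= toggle_headK // size_bseq.
pose act (u : {perm T}) c := (u * perm (can_inj (togK c)))%g.
exists {perm T}, act, 1%g; split=> [c u | u cs /andP[cs0 csR] cs_s].
  by apply/permP => w; rewrite /act !permM !permE togK.
(* Evaluate both permutations at the word that [u] sends to the empty word. *)
apply: contraTneq cs0 => /(congr1 (fun s : {perm T} => val (s (u^-1 [bseq])%g))).
have -> s w : val ((foldl act s cs : {perm T}) w) =
  foldl (fun u c => toggle_head R c u) (val (s w)) cs.
  elim: cs s {csR cs_s} => //= c cs IHcs s; rewrite IHcs.
  by rewrite /act permM permE.
rewrite permKV foldl_toggle_head //.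
  by move/(congr1 size); rewrite catrevE cats0 size_rev /= => ->.
by case: (cs).
Qed.

(** * Reduced walks that stay put instead of stepping to a given vertex *)

Section Bounce.

Variables (W : eqType) (L : eqType) (R : nat) (act : W -> L -> W) (w0 : W).
Hypothesis actK : forall c, involutive (act^~ c).
Hypothesis act_reduced : forall u cs, 0 < size cs <= R ->
  sorted (fun a b => a != b) cs -> foldl act u cs != u.

Definition bounce u c := if act u c == w0 then u else act u c.

Lemma foldl_bounceP u cs : foldl bounce u cs = foldl act u cs \/
  exists s1 c s2, [/\ cs = s1 ++ c :: s2, foldl bounce u s1 = foldl act u s1 &
    act (foldl act u s1) c = w0].
Proof.
elim: cs u => [|c cs IHcs] u /=; first by left.
have [uc | uc] := eqVneq (act u c) w0; first by right; exists [::], c, cs.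
have buc : bounce u c = act u c by rewrite /bounce (negPf uc).
rewrite buc; case: (IHcs (act u c)) => [|[s1 [d [s2 [-> Es1 w0E]]]]]; first by left.
by right; exists (c :: s1), d, s2; rewrite /= buc.
Qed.

(* Two bounces would give a short closed walk at [w0]; a closed walk with at
   most one bounce gives a short closed walk of the action itself. *)
Lemma foldl_bounce_neq u cs : path.cycle (fun a b => a != b) cs ->
  1 < size cs <= R -> foldl bounce u cs != u.
Proof.
move=> ncs /andP[cs1 csR]; have scs : sorted (fun a b => a != b) cs.
  by case: cs ncs {cs1 csR} => //= c cs; rewrite rcons_path => /andP[].
case: (foldl_bounceP u cs) => [-> | [s1 [c [s2 [Dcs Es1 Ec]]]]].
  by rewrite act_reduced // csR ltnW.
apply/eqP; rewrite Dcs foldl_cat /= Es1 => us.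
set u1 := foldl act u s1 in Ec us.
have bu1 : bounce u1 c = u1 by rewrite /bounce Ec eqxx.
have au1 : act w0 c = u1 by rewrite -Ec actK.
have ss : sorted (fun a b => a != b) (c :: s2).
  by move: scs; rewrite Dcs => /cat_sorted2[].
have sR : size (c :: s2) <= R.
  by apply: leq_trans csR; rewrite Dcs size_cat leq_addl.
rewrite bu1 in us; case: (foldl_bounceP u1 s2) => [us2 | [s3 [d [s4 [Ds2 _ Ed]]]]].
  (* One bounce: omitting it leaves a closed walk at [u1], reduced because [cs] is cyclically
     reduced, and nonempty because [1 < size cs]. *)
  have : foldl act u1 (s2 ++ s1) != u1.
    apply: act_reduced.
      move: cs1 csR; rewrite Dcs !size_cat /= addnS addnC ltnS => -> /=.
      exact: ltnW.
    move: ncs; rewrite -(rot_cycle (size s1)) Dcs rot_size_cat /= rcons_path.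
    by case/andP=> /path_sorted.
  by rewrite foldl_cat -us2 us eqxx.
(* Two bounces: [c] leads from [w0] to [u1], and [s3] followed by [d] leads back to [w0]. *)
have : foldl act w0 (c :: rcons s3 d) != w0.
  apply: act_reduced.
    by apply: leq_trans sR; rewrite Ds2 /= size_cat size_rcons /= addnS !ltnS leq_addr.
  by move: ss; rewrite Ds2 -cat_rcons -cat_cons => /cat_sorted2[].
by rewrite /= au1 foldl_rcons Ed eqxx.
Qed.

End Bounce.

Lemma next_next_neq (T : eqType) (s : seq T) x :
  uniq s -> 2 < size s -> x \in s -> next s (next s x) != x.
Proof.
move=> us s2 xs; have [i t Ds] := rot_to xs.
rewrite -!(next_rot i us); move: us s2; rewrite -(rot_uniq i) -(size_rot i) Ds.
case: t {Ds} => [|y [|z t]] //= /andP[]; rewrite !inE !negb_or => /and3P[xy xz _] _ _.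
by rewrite !eqxx ifN eq_sym.
Qed.

(** * Colourings of complete graphs by classes of large girth *)

Section Labelling.

Variables (W J : finType) (r R : nat) (act : W -> 'I_r -> W) (w0 : W).
Hypothesis actK : forall c, involutive (act^~ c).
Hypothesis R_gt1 : 1 < R.
Hypothesis act_reduced : forall u cs, 0 < size cs <= R ->
  sorted (fun a b => a != b) cs -> foldl act u cs != u.

(* [J] only serves to take several copies of the relabelled action. *)
Definition colour := ({perm W} * J)%type.

Definition pact (a : colour) u c := a.1 (act ((a.1)^-1%g u) c).

Lemma pactK a c : involutive (pact a ^~ c).
Proof. by move=> u; rewrite /pact permK actK permKV. Qed.

Lemma foldl_pact a u cs : foldl (pact a) u cs = a.1 (foldl act ((a.1)^-1%g u) cs).
Proof.
by elim: cs u => [|c cs IHcs] u /=; rewrite ?permKV // IHcs /pact permK.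
Qed.

Lemma pact_reduced a u cs : 0 < size cs <= R ->
  sorted (fun x y => x != y) cs -> foldl (pact a) u cs != u.
Proof.
move=> csR scs; rewrite foldl_pact -[X in _ != X](permKV a.1 u).
by rewrite (inj_eq perm_inj) act_reduced.
Qed.

Lemma pact_neq a u c : pact a u c != u.
Proof. by have:= @pact_reduced a u [:: c]; apply; rewrite //= ltnW. Qed.

Definition joining u v := [set b : colour * 'I_r | pact b.1 u b.2 == v].

Lemma joiningC u v : joining u v = joining v u.
Proof.
by apply/setP=> b; rewrite !inE; apply/eqP/eqP => <-; rewrite pactK.
Qed.

(** Relabelling all copies by a permutation that takes [u], [v] to [u'], [v'] is injective. *)
Lemma card_joining_le u v u' v' : u != v -> u' != v' ->
  #|joining u v| <= #|joining u' v'|.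
Proof.
move=> uv u'v'; pose t := (tperm u u' * tperm (tperm u u' v) v')%g.
have tu : t u = u'.
  rewrite permM tpermL tpermD // [_ == u']eq_sym //.
  by rewrite -[X in X != _](tpermL u u') (inj_eq perm_inj).
have tv : t v = v' by rewrite permM tpermL.
move: t tu tv => t tu tv; pose f (b : colour * 'I_r) := (((b.1.1 * t)%g, b.1.2), b.2).
have f_inj : injective f.
  by move=> [[s j] c] [[s' j'] c'] [/mulIg-> -> ->].
rewrite -(card_imset _ f_inj); apply: subset_leq_card; apply/subsetP => _ /imsetP[b bP ->].
move: bP; rewrite !inE /pact /= => /eqP bv.
by rewrite invMg !permM -tu permK bv tv.
Qed.

Variables (w1 : W) (b0 : colour * 'I_r).
Hypothesis w01 : w0 != w1.

Let q := #|joining w0 w1|.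

Lemma card_joining u v : u != v -> #|joining u v| = q.
Proof. by move=> uv; apply/eqP; rewrite eqn_leq !card_joining_le. Qed.

(** Double counting: each copy and letter lead from [w0] to exactly one other vertex. *)
Lemma card_joining_total : q * #|W|.-1 = #|{: colour}| * r.
Proof.
transitivity #|{: colour * 'I_r}|; last by rewrite card_prod card_ord.
rewrite -[RHS]sum1_card [RHS](partition_big (fun b => pact b.1 w0 b.2) (predC1 w0)) /=; last first.
  by move=> b _; apply: pact_neq.
rewrite [RHS](eq_bigr (fun=> q)) => [|v vw0]; last first.
  by rewrite sum1dep_card -(card_joining (u := w0) (v := v)) // eq_sym.
by rewrite sum_nat_const mulnC cardC1.
Qed.

Definition point := ('I_q * {w | w != w0})%type.

Lemma card_point : #|{: point}| = #|{: colour}| * r.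
Proof.
by rewrite card_prod card_ord card_sig -card_joining_total -(cardC1 w0).
Qed.

(* An edge inside a fibre lies over the edge from that fibre to [w0]. *)
Definition target (u v : W) := if u == v then w0 else v.

(** The sum makes the index symmetric and, for fixed [x], injective in [y.1]. The default [b0] is
    never reached, by [label_index_lt]. *)
Definition label (x y : point) :=
  nth b0 (enum (joining (val x.2) (target (val x.2) (val y.2)))) ((x.1 + y.1) %% q).

Lemma labelC x y : label x y = label y x.
Proof.
rewrite /label addnC /target [val y.2 == _]eq_sym.
by case: eqP => [-> // | _]; rewrite joiningC.
Qed.

Lemma target_neq (x y : point) : val x.2 != target (val x.2) (val y.2).
Proof.
rewrite /target; case: (eqVneq (val x.2) (val y.2)) => [_ | //].
exact: (valP x.2).
Qed.

Lemma label_index_lt (x y : point) :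
  (x.1 + y.1) %% q < size (enum (joining (val x.2) (target (val x.2) (val y.2)))).
Proof.
by rewrite -cardE card_joining ?target_neq // ltn_mod (leq_ltn_trans _ (ltn_ord x.1)).
Qed.

Lemma pact_label x y :
  pact (label x y).1 (val x.2) (label x y).2 = target (val x.2) (val y.2).
Proof.
by have := mem_nth b0 (label_index_lt x y); rewrite mem_enum inE => /eqP.
Qed.

Lemma bounce_label x y :
  bounce (pact (label x y).1) w0 (val x.2) (label x y).2 = val y.2.
Proof.
rewrite /bounce pact_label /target.
case: (eqVneq (val x.2) (val y.2)) => [-> | xy]; rewrite ?eqxx //.
by rewrite (negPf (valP y.2)).
Qed.

(** Bouncing along the label recovers [y.2]; within that fibre the index determines [y.1]. *)
Lemma label_inj x : injective (label x).
Proof.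
move=> y z lyz; have yz2 : val y.2 = val z.2 by rewrite -(bounce_label x y) lyz bounce_label.
have := lyz; rewrite {1}/label yz2 => /eqP.
rewrite nth_uniq ?enum_uniq ?label_index_lt //; last first.
  by have := label_index_lt x y; rewrite yz2.
rewrite eqn_modDl !modn_small ?ltn_ord // => /eqP /val_inj yz1.
by rewrite [y]surjective_pairing [z]surjective_pairing yz1 (val_inj yz2).
Qed.

(** By [label_inj], labels at [x] with the same copy differ in their letter. *)
Lemma label_degree a x (s : seq point) :
  uniq s -> {in s, forall y, (label x y).1 = a} -> size s <= r.
Proof.
move=> us sa; rewrite -(size_map (fun y => (label x y).2)).
have us' : uniq (map (fun y => (label x y).2) s).
  rewrite map_inj_in_uniq // => y z ys zs lyz; apply: (@label_inj x).
  by rewrite [LHS]surjective_pairing [RHS]surjective_pairing !sa // lyz.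
by rewrite -(card_uniqP us') -[X in _ <= X](card_ord r) max_card.
Qed.

Lemma label_girth a (s : seq point) :
  uniq s -> 2 < size s -> path.cycle (fun x y => (label x y).1 == a) s -> R < size s.
Proof.
move=> us s2 sa; rewrite ltnNge; apply/negP => sR.
pose nx := next s; pose letter x := (label x (nx x)).2.
have letterP x : x \in s -> label x (nx x) = (a, letter x).
  move=> /(next_cycle sa)/eqP /= xa; rewrite /letter -xa.
  exact: surjective_pairing.
(* Equal consecutive letters would make the cycle turn back, by [label_inj]. *)
have cneq : path.cycle (fun c d => c != d) (map letter s).
  rewrite cycle_map; apply: (sub_in_cycle (P := [in s])) (cycle_next us); last exact/allP.
  move=> x y xs ys /eqP /= Dy; apply: contraNneq (next_next_neq us s2 xs) => lxy.
  apply/eqP; apply: (@label_inj y); rewrite [RHS]labelC -{2}Dy !letterP // lxy -Dy.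
  by rewrite -/(nx _) letterP // Dy.
have walk x p : {subset belast x p <= s} -> fpath nx x p ->
    foldl (bounce (pact a) w0) (val x.2) (map letter (belast x p)) = val (last x p).2.
  elim: p x => //= y p IHp x xps /andP[/eqP Dy yp].
  have xs : x \in s by apply: xps; rewrite mem_head.
  have := bounce_label x y; rewrite -Dy letterP //= => ->.
  by rewrite Dy; apply: IHp => // z zp; apply: xps; rewrite in_cons zp orbT.
have [x [p Ds]] : exists x p, s = x :: p by case: (s) s2 => // x p; exists x, p.
have xE : foldl (bounce (pact a) w0) (val x.2) (map letter s) = val x.2.
  rewrite {1}Ds -(belast_rcons x p x) walk ?last_rcons ?belast_rcons -?Ds //.
  by have := cycle_next us; rewrite {2}Ds.
have := foldl_bounce_neq w0 (@pactK a) (@pact_reduced a) (val x.2) cneq.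
by rewrite size_map sR (ltnW s2) xE eqxx => /(_ isT).
Qed.

End Labelling.

Lemma high_girth_labelling (r R N : nat) : 0 < r ->
  exists (V C : finType) (l : V -> V -> C),
  [/\ #|V| = #|C| * r, N < #|C|, forall x y, l x y = l y x,
    forall a x s, uniq s -> {in s, forall y, l x y = a} -> size s <= r &
    forall a s, uniq s -> 2 < size s -> path.cycle (fun x y => l x y == a) s ->
      R < size s].
Proof.
(* The bound [R.+2] ensures the condition [1 < R] of the labelling; below, [N.+1] copies of each
   relabelling give more than [N] colours. *)
move=> r_gt0; have [W [act [w0 [actK act_red]]]] := high_girth_action r R.+2.
pose c0 := Ordinal r_gt0.
have w01 : w0 != act w0 c0 by rewrite eq_sym; apply: (act_red w0 [:: c0]).
pose b0 : colour W 'I_N.+1 * 'I_r := ((1%g, ord0), c0).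
exists (point 'I_N.+1 act w0 (act w0 c0)), (colour W 'I_N.+1).
exists (fun x y => (label b0 x y).1); split.
- exact: (card_point _ _ act_red w01).
- rewrite card_prod card_ord; apply: leq_pmull.
  by apply/card_gt0P; exists 1%g.
- by move=> x y; rewrite (labelC actK).
- by move=> a x s; apply: (label_degree w01).
- move=> a s us s2 sa; apply: ltnW; apply: ltnW.
  exact: (label_girth actK act_red w01 us s2 sa).
Qed.

(** * Monochromatic stars and cliques in edge colourings *)

Lemma set2_eqP (T : finType) (x y x' y' : T) : [set x; y] = [set x'; y'] ->
  (x = x' /\ y = y') \/ (x = y' /\ y = x').
Proof.
move=> E; have: y' \in [set x; y] by rewrite E set22.
have: x' \in [set x; y] by rewrite E set21.
have: y \in [set x'; y'] by rewrite -E set22.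
have: x \in [set x'; y'] by rewrite -E set21.
by do 4!case/set2P=> ?; subst; auto.
Qed.

(** A set determines its pair up to order, which the symmetry of [l] absorbs; [a0] is the value on
    sets that are not of this form. *)
Lemma symmetric_on_pairs (T : finType) (C : Type) (a0 : C) (l : T -> T -> C) :
  (forall x y, l x y = l y x) -> exists c : {set T} -> C, forall x y, c [set x; y] = l x y.
Proof.
move=> lC; exists (fun S : {set T} =>
  if [pick p : T * T | S == [set p.1; p.2]] is Some p then l p.1 p.2 else a0) => x y.
case: pickP => [p /eqP/set2_eqP[][-> ->] // | /(_ (x, y))].
by rewrite eqxx.
Qed.

(** By pigeonhole, some colour occurs on more than [r] edges at [x]. *)
Lemma mono_copy_star (r k : nat) (F G : sgraph) (c : edge_coloring k G) (x : G) :
  isomorphic F (star r.+1) -> k * r < #|[set y | adj x y]| -> mono_copy F c.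
Proof.
move=> [g [g' gK g'K] gadj] degx.
have [a ra] : exists a, r < #|[set y | adj x y & c [set x; y] == a]|.
  apply/existsP; apply: contraLR degx; rewrite negb_exists -leqNgt => /forallP le_r.
  rewrite -sum1_card (partition_big (fun y => c [set x; y]) xpredT) //=.
  rewrite -[X in X * r](card_ord k) -sum_nat_const; apply: leq_sum => a _.
  have := le_r a; rewrite -leqNgt; apply: leq_trans.
  by rewrite -sum1_card; apply: eq_leq; apply: eq_bigl => y; rewrite !inE.
pose leaf (j : 'I_r.+1) := enum_val (widen_ord ra j).
have leafP j : adj x (leaf j) /\ c [set x; leaf j] = a.
  by have := enum_valP (widen_ord ra j); rewrite inE => /andP[? /eqP].
have leaf_inj : injective leaf by move=> i j /enum_val_inj /(congr1 val) /= /val_inj.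
pose f (o : star r.+1) := if o is Some j then leaf j else x.
have f_inj : injective f.
  move=> [i|] [j|] //=; first by move/leaf_inj->.
    by move=> lx; have [] := leafP i; rewrite lx adj_irrefl.
  by move=> lx; have [] := leafP j; rewrite -lx adj_irrefl.
exists (f \o g), a; split; first exact: inj_comp f_inj (can_inj gK).
move=> u v; rewrite -gadj /=; case: (g u) (g v) => [i|] [j|] //= _.
by rewrite adj_sym setUC; exact: leafP.
Qed.

Lemma forces_of_clique k (I : finType) (fam : I -> sgraph) m (G : sgraph)
    (h : 'I_m -> G) : (forall i j, i != j -> adj (h i) (h j)) ->
  forces k fam (complete m) -> forces k fam G.
Proof.
move=> hadj fm c; have h_inj : injective h.
  by move=> i j hij; apply/eqP; apply: contraT => /hadj; rewrite hij adj_irrefl.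
have [i [f [a [f_inj fP]]]] := fm (fun S => c (h @: S)).
exists i, (h \o f), a; split=> [|x y /fP[fxy <-]]; first exact: inj_comp.
by rewrite imsetU !imset_set1; split=> //; apply: hadj.
Qed.

Lemma chromatic_number_le (G : sgraph) m : colorable G m -> chromatic_number G <= m.
Proof. by rewrite /chromatic_number; case: ex_minnP => n _; apply. Qed.

Lemma brooks_clique (G : sgraph) D : 2 < D -> (forall x : G, #|[set y | adj x y]| <= D) ->
  D < chromatic_number G ->
  exists h : 'I_D.+1 -> G, forall i j, i != j -> adj (h i) (h j).
Proof.
move=> D_gt2 deg_le chiG; apply: NNPP => noclique.
suff /chromatic_number_le : colorable G D by rewrite leqNgt chiG.
have [|f fP] := brooks (@adj_sym G) (@adj_irrefl G) deg_le D_gt2.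
  move=> K KD; apply: NNPP => Kc; apply: noclique.
  exists (fun i => enum_val (cast_ord (esym KD) i)) => i j ij.
  apply: contraT => nij; case: Kc; exists (enum_val (cast_ord (esym KD) i)).
  exists (enum_val (cast_ord (esym KD) j)); split; rewrite ?enum_valP //.
  by rewrite (inj_eq enum_val_inj) (inj_eq (@cast_ord_inj _ _ _)).
apply/existsP; exists [ffun x => f x]; apply/forallP=> x; apply/forallP => y.
by apply/implyP => /fP; rewrite !ffunE.
Qed.

Lemma card_complete_nbrs m (x : complete m.+1) : #|[set y | adj x y]| = m.
Proof.
rewrite (_ : [set y | adj x y] = [set~ x]); first by rewrite cardsC1 card_ord.
by apply/setP => y; rewrite !inE eq_sym.
Qed.

(** * Niceness *)

Section Family.

Variables (r : nat) (I : finType) (fam : I -> sgraph).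
Hypothesis r_gt0 : 0 < r.
Hypothesis hstar : exists i, isomorphic (fam i) (star r.+1).
Hypothesis hcycle :
  forall i, ~ isomorphic (fam i) (star r.+1) -> has_cycle (fam i).

Lemma complete_not_forced N : exists k, N < k /\
  forall n, n <= k * r -> ~ forces k fam (complete n).
Proof.
(* No cycle in a member of the family is longer than [R]. *)
pose R := \max_(i : I) #|fam i|.
have [V [C [l [VE CN lC ldeg lgirth]]]] := @high_girth_labelling r R N r_gt0.
exists #|C|; split=> // n nV fn.
rewrite -VE in nV; pose p (i : 'I_n) : V := enum_val (widen_ord nV i).
have p_inj : injective p by move=> i j /enum_val_inj /(congr1 val) /= /val_inj.
have C_gt0 : 0 < #|C| by apply: leq_ltn_trans CN.
have [|c cE] := @symmetric_on_pairs _ _ (Ordinal C_gt0)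
  (fun i j => enum_rank (l (p i) (p j))); first by move=> i j; rewrite lC.
have [i [f [a [f_inj fP]]]] := fn c.
have h_inj : injective (p \o f) := inj_comp p_inj f_inj.
have hP x y : adj x y -> l (p (f x)) (p (f y)) = enum_val a.
  by move=> /fP[_]; rewrite cE => <-; rewrite enum_rankK.
(* A monochromatic star violates the degree bound, any other member the girth bound. *)
have [[g [g' gK g'K] gadj] | /hcycle[s [/andP[cs us] s2]]] :=
    classic (isomorphic (fam i) (star r.+1)).
  have := ldeg (enum_val a) (p (f (g' None))) [seq p (f (g' (Some j))) | j : 'I_r.+1].
  rewrite size_map size_enum_ord ltnn => H.
  suff: false by []; apply: H.
    rewrite map_inj_uniq ?enum_uniq // => j j' /h_inj /(can_inj g'K).
    by case.
  by move=> _ /mapP[j _ ->]; apply: hP; rewrite -gadj !g'K.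
have: R < size (map (p \o f) s).
  apply: (lgirth (enum_val a)); rewrite ?size_map ?map_inj_uniq //.
  rewrite cycle_map; apply: sub_cycle cs => x y /hP /= ->; exact: eqxx.
rewrite size_map ltnNge => /negP; apply.
rewrite -(card_uniqP us); apply: leq_trans (max_card _) _.
exact: (leq_bigmax (F := fun i => #|fam i|)).
Qed.

Lemma nice_of_not_forced k : 2 < k * r ->
  (forall n, n <= k * r -> ~ forces k fam (complete n)) -> nice k fam.
Proof.
move=> D_gt2 nf; have [i0 i0star] := hstar.
set D := k * r in D_gt2 nf.
have f2 : forces k fam (complete D.+2).
  move=> c; exists i0; apply: (mono_copy_star c (x := ord0 : complete D.+2) i0star).
  by rewrite card_complete_nbrs.
(* The Ramsey number is [D.+1] or [D.+2], according to whether the complete graph on [D.+1] vertices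
   is forced. *)
have [f1 | f1] := classic (forces k fam (complete D.+1)).
  exists D.+1; split=> [|G chiG c].
    by split=> // m; apply: contraPT; rewrite -ltnNge ltnS => /nf.
  have [degG | [x degx]] : (forall x : G, #|[set y | adj x y]| <= D) \/
      exists x : G, D < #|[set y | adj x y]|.
  - have [/forallP | /forallPn[x]] := boolP [forall x : G, #|[set y | adj x y]| <= D].
      by left.
    by rewrite -ltnNge; right; exists x.
  - have [|h hP] := brooks_clique D_gt2 degG; first by rewrite chiG.
    exact: (forces_of_clique hP f1).
  by exists i0; apply: mono_copy_star degx.
exists D.+2; split=> [|G chiG c].
  split=> // m; apply: contraPT; rewrite -ltnNge ltnS leq_eqVlt.
  by move=> /predU1P[-> | /nf].
have [/forallP degG | /forallPn[x]] := boolP [forall x : G, #|[set y | adj x y]| <= D].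
  (* Brooks' theorem for the degree bound [D.+1] gives a clique on [D.+2] vertices. *)
  have [||h hP] := @brooks_clique G D.+1 (leqW D_gt2); first by move=> x; exact: leqW.
    by rewrite chiG.
  exact: (forces_of_clique hP f2).
by rewrite -ltnNge => degx; exists i0; apply: mono_copy_star degx.
Qed.

End Family.

Theorem theorem1p6 (r : nat) (hr : 0 < r) (I : finType) (fam : I -> sgraph)
  (hstar : exists i, isomorphic (fam i) (star r.+1))
  (hcycle : forall i, ~ isomorphic (fam i) (star r.+1) -> has_cycle (fam i)) :
  forall N : nat, exists k : nat, N < k /\ nice k fam.
Proof.
(* The summand 2 yields [2 < k * r], as Brooks' theorem requires. *)
move=> N; have [k [kN nf]] := complete_not_forced hr hcycle (N + 2).
exists k; split; first by apply: leq_ltn_trans kN; rewrite leq_addr.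
apply: (nice_of_not_forced hstar) nf.
apply: (leq_trans (n := k)); last exact: leq_pmulr.
by apply: leq_ltn_trans kN; rewrite leq_addl.
Qed.
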